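(* Let $m\geq 4$, let $\Omega$ be a finite set of size $n\geq 3$, let $R_0,R_1,R_2,R_3$ be the trivial relations on $\Omega$, and let $G$ be a group acting on $\Omega\times\Omega\times\Omega$ such that $\Omega\times\Omega\times\Omega\setminus\bigcup_{i=0}^3 R_i$ is stable under $G$. Carry out the following procedure. 1. Let $\mathbb{O}$ be the set of orbits of $G$ on $\Omega\times\Omega\times\Omega\setminus\bigcup_{i=0}^3 R_i$, and let $\mathbb{P}$ be the set of all unordered partitions of the set $\mathbb{O}$ into exactly $m-3$ parts. 2. For $P\in\mathbb{P}$ and $U\in P$ put $A_U=\bigcup_{O\in U}O$, and let $\hat P=\{R_0,R_1,R_2,R_3\}\cup\{A_U : U\in P\}$, a partition of $\Omega\times\Omega\times\Omega$. Let $\hat{\mathbb{P}}=\{\hat P : P\in\mathbb{P}\}$. 3. Let $\mathbb{A}\subseteq\hat{\mathbb{P}}$ be the set of those members of $\hat{\mathbb{P}}$ that satisfy conditions (1), (2) and (3) in the definition of an association scheme on triples (AST). 4. Determine which members of $\mathbb{A}$ lie in the same orbit under the action of $S_\Omega$ on unordered partitions of $\Omega\times\Omega\times\Omega$ given by $\sigma(\{R_i\}_{i=0}^m)=\{\sigma(R_i)\}_{i=0}^m$. 5. Let $\mathbb{T}\subseteq\mathbb{A}$ be a transversal of these orbits, i.e. $\mathbb{T}$ contains exactly one member of $\mathbb{A}$ from each $S_\Omega$-orbit that meets $\mathbb{A}$. Then $\mathbb{T}$ gives all ASTs of order $m$ on $\Omega$, up to isomorphism, such that each nontrivial relation is invariant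 under the action of $G$. That is, every member of $\mathbb{T}$ is an AST of order $m$ on $\Omega$ all of whose nontrivial relations are $G$-invariant, and every AST of order $m$ on $\Omega$ all of whose nontrivial relations are $G$-invariant is isomorphic to exactly one member of $\mathbb{T}$.
   Context: Let $\Omega$ be a finite set with $|\Omega|=n\geq 3$. An association scheme on triples (AST) of order $m\geq 4$ on $\Omega$ is a partition $X=\{R_i\}_{i=0}^m$ of $\Omega\times\Omega\times\Omega$ (into $m+1$ nonempty parts) such that: (1) For each $i\in\{0,\ldots,m\}$ there is a constant $n_i^{(3)}\in\mathbb{N}\cup\{0\}$ such that $|\{z\in\Omega : (x,y,z)\in R_i\}|=n_i^{(3)}$ for any pair of distinct $x,y\in\Omega$. (2) For any $i,j,k,l\in\{0,\ldots,m\}$ there is a constant $p_{ijk}^l\in\mathbb{N}\cup\{0\}$ such that $|\{w\in\Omega : (w,y,z)\in R_i,\ (x,w,z)\in R_j,\ (x,y,w)\in R_k\}|=p_{ijk}^l$ for every $(x,y,z)\in R_l$. (3) For any $i\in\{0,\ldots,m\}$ and $\sigma\in S_3$ there is $j\in\{0,\ldots,m\}$ such that $R_i^\sigma:=\{(x_{\sigma(1)},x_{\sigma(2)},x_{\sigma(3)}) : (x_1,x_2,x_3)\in R_i\}=R_j$. (4) The first four relations are the trivial relations $R_0=\{(x,x,x):x\in\Omega\}$, $R_1=\{(y,x,x):x,y\in\Omega,\ x\neq y\}$, $R_2=\{(x,y,x):x,y\in\Omega,\ x\neq y\}$, $R_3=\{(x,x,y):x,y\in\Omega,\ x\neq y\}$.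 The relations $R_4,\ldots,R_m$ are called the nontrivial relations. For $R\subseteq\Omega\times\Omega\times\Omega$ and $\sigma\in S_\Omega$ (the symmetric group on $\Omega$), put $\sigma(R)=\{(\sigma(x),\sigma(y),\sigma(z)):(x,y,z)\in R\}$. Two ASTs $\{R_i\}_{i=0}^m$ and $\{S_i\}_{i=0}^m$ of order $m$ on $\Omega$ are isomorphic if there is $\sigma\in S_\Omega$ with $\{\sigma(R_i)\}_{i=0}^m=\{S_i\}_{i=0}^m$ as unordered sets. ASTs are treated as unordered partitions. A relation $R\subseteq\Omega\times\Omega\times\Omega$ is invariant under the action of $G$ if $g\cdot t\in R$ for all $g\in G$ and $t\in R$. *)

(* Defs.v *)
From HB Require Import structures.
From mathcomp Require Import all_boot all_fingroup primitive_action.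
From mathcomp Require Import boolp.

Set Implicit Arguments.
Unset Strict Implicit.
Unset Printing Implicit Defensive.

Local Open Scope group_scope.

Notation triple Omega := (3.-tuple Omega).

(* An unordered family {R_i} of relations is the set of its members: the
   quantifiers over indices i, j, k, l become quantifiers over members, and
   "order m" becomes "m + 1 members". *)
Notation relations Omega := {set {set triple Omega}}.

Section Scheme.
Variable Omega : finType.
Implicit Types (R : {set triple Omega}) (X Y : relations Omega).

Definition triv_rel0 : {set triple Omega} := [set [tuple x; x; x] | x : Omega].
Definition triv_rel1 : {set triple Omega} :=
  [set [tuple y; x; x] | x in Omega, y in Omega & x != y].
Definition triv_rel2 : {set triple Omega} :=
  [set [tuple x; y; x] | x in Omega, y in Omega & x != y].
Definition triv_rel3 : {set triple Omega} :=
  [set [tuple x; x; y] | x in Omega, y in Omega & x != y].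

Definition trivial_relations : relations Omega :=
  [set triv_rel0; triv_rel1; triv_rel2; triv_rel3].

Definition nontrivial_triples : {set triple Omega} :=
  ~: (triv_rel0 :|: triv_rel1 :|: triv_rel2 :|: triv_rel3).

Definition ast_valency X : Prop :=
  forall R, R \in X -> exists n3 : nat,
    forall x y : Omega, x != y -> #|[set z | [tuple x; y; z] \in R]| = n3.

Definition ast_intersection X : Prop :=
  forall Ri Rj Rk Rl, Ri \in X -> Rj \in X -> Rk \in X -> Rl \in X ->
  exists p : nat, forall x y z : Omega, [tuple x; y; z] \in Rl ->
    #|[set w | [&& [tuple w; y; z] \in Ri,
                   [tuple x; w; z] \in Rj
                 & [tuple x; y; w] \in Rk]]| = p.

Definition permute_coords (s : 'S_3) R : {set triple Omega} :=
  [set [tuple tnth t (s i) | i < 3] | t in R].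

Definition ast_symmetric X : Prop :=
  forall R (s : 'S_3), R \in X -> permute_coords s R \in X.

Definition is_ast (m : nat) X : Prop :=
  [/\ partition X [set: triple Omega] /\ #|X| = m.+1,
      ast_valency X,
      ast_intersection X,
      ast_symmetric X
    & trivial_relations \subset X].

Definition relations_action :=
  (('P * 3)^*^*)%act : {action {perm Omega} &-> relations Omega}.

Lemma relations_actionE X (s : {perm Omega}) :
  relations_action X s =
    [set [set map_tuple s t | t in R] | R : {set triple Omega} in X].
Proof. by []. Qed.

Definition ast_isomorphic X Y : Prop :=
  exists s : {perm Omega}, relations_action X s = Y.

Definition isom_transversal (T A : {set relations Omega}) : Prop :=
  T \subset A /\
  forall X, orbit relations_action [set: {perm Omega}] X :&: A != set0 ->
    #|T :&: orbit relations_action [set: {perm Omega}] X| = 1%N.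

End Scheme.

(* The library's actions require a finite group; here G is arbitrary. *)
Definition group_action (G : groupType) (T : Type) (act : G -> T -> T) : Prop :=
  (forall t, act 1 t = t) /\ (forall g h t, act (g * h) t = act g (act h t)).

Section Procedure.
Variables (Omega : finType) (G : groupType).
Variable act : G -> triple Omega -> triple Omega.

Definition invariant_rel (R : {set triple Omega}) : Prop :=
  forall g t, t \in R -> act g t \in R.

Definition orbit_of (t : triple Omega) : {set triple Omega} :=
  [set u | `[< exists g, act g t = u >]].

Definition orbits : {set {set triple Omega}} :=
  [set orbit_of t | t in nontrivial_triples Omega].

Definition orbit_partitions (m : nat) : {set {set {set {set triple Omega}}}} :=
  [set P | partition P orbits & #|P| == m - 3].

(* cover U is the union A_U of the orbits belonging to the part U. *)
Definition hat (P : {set {set {set triple Omega}}}) : relations Omega :=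
  trivial_relations Omega :|: [set cover U | U in P].

Definition candidates (m : nat) : {set relations Omega} :=
  [set X in [set hat P | P in orbit_partitions m]
     | `[< [/\ ast_valency X, ast_intersection X & ast_symmetric X] >]].

Definition invariant_ast (m : nat) (X : relations Omega) : Prop :=
  is_ast m X /\
  forall R, R \in X :\: trivial_relations Omega -> invariant_rel R.

End Procedure.

(* Main.v *)
Require Import Defs.
From HB Require Import structures.
From mathcomp Require Import all_boot all_fingroup primitive_action.
From mathcomp Require Import boolp.

(** The set called [candidates act m] is exactly the set of ASTs of order [m]
    whose nontrivial relations are invariant ([mem_candidates]); the theorem
    then only says that a transversal of the isomorphism classes meeting this
    set has exactly one element in each of them.

    A set of nontrivial triples is invariant precisely when it is a union of
    orbits, and the orbits partition the nontrivial triples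
    ([orbits_partition]). So a partition of the nontrivial triples into
    invariant sets is a coarsening of the partition into orbits, which amounts
    to a partition of the set of orbits: grouping orbits and taking unions
    produces a coarsening ([partition_partition]), and every coarsening arises
    in this way ([coarsening_is_partition_of_partition]). The remaining triples
    are partitioned by the four trivial relations, which an AST must contain
    ([trivial_relations_partition]); hence adding these relations to, or
    removing them from, a partition translates between partitions of all triples
    containing them and partitions of the nontrivial triples
    ([partitionUC], [partitionDC]). They are four distinct relations
    ([card_trivial_relations]), so [m + 1] relations in all correspond to
    [m - 3] parts. *)

Set Implicit Arguments.
Unset Strict Implicit.
Unset Printing Implicit Defensive.

Local Open Scope group_scope.

(** * Coarsenings and complements of partitions *)

Section Partitions.
Variable T : finType.
Implicit Types (D B : {set T}) (P Y : {set {set T}}).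

Definition coarsens P Y :=
  forall A B, A \in P -> B \in Y -> ~~ [disjoint A & B] -> A \subset B.

Lemma cover_coarser_block P Y D B :
  partition P D -> partition Y D -> coarsens P Y -> B \in Y ->
  cover (P ::&: B) = B.
Proof.
move=> partP partY PY YB; apply/setP => x; apply/bigcupP/idP => [[A]|Bx].
  by rewrite !inE => /andP[_ /subsetP sAB] /sAB.
have Dx : x \in cover P.
  by rewrite (cover_partition partP) (subsetP (partitionS partY YB)).
exists (pblock P x); last by rewrite mem_pblock.
rewrite !inE pblock_mem //=; apply: PY => //; first exact: pblock_mem.
by apply/pred0Pn; exists x; rewrite /= mem_pblock Dx.
Qed.

(** Group the blocks of [P] according to the block of [Y] that contains them:
    taking unions recovers the blocks of [Y]. *)
Lemma coarsening_is_partition_of_partition P Y D :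
    partition P D -> partition Y D -> coarsens P Y ->
  exists2 Q, partition Q P & [set cover U | U in Q] = Y.
Proof.
move=> partP partY PY; have coverB := cover_coarser_block partP partY PY.
exists [set P ::&: B | B in Y]; last first.
  apply/setP => B; apply/imsetP/idP => [[U /imsetP[B' YB' ->] ->]|YB].
    by rewrite coverB.
  by exists (P ::&: B); rewrite ?coverB // imset_f.
have meetP A : A \in P -> exists x, x \in A.
  by move/(partition_neq0 partP)/set0Pn.
apply/and3P; split.
- apply/eqP/setP => A; apply/bigcupP/idP => [[U /imsetP[B _ ->]]|PA].
    by rewrite !inE => /andP[].
  have [x Ax] := meetP A PA.
  have Yx : x \in cover Y.
    by rewrite (cover_partition partY) (subsetP (partitionS partP PA)).
  have Yb := pblock_mem Yx.
  exists (P ::&: pblock Y x); first exact: imset_f.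
  rewrite !inE PA; apply: PY => //.
  by apply/pred0Pn; exists x; rewrite /= Ax mem_pblock.
- apply/trivIsetP => _ _ /imsetP[B YB ->] /imsetP[C YC ->] neq.
  apply/pred0P => A /=; apply/negP => /andP[].
  rewrite !inE => /andP[PA /subsetP sAB] /andP[_ /subsetP sAC].
  have [x Ax] := meetP A PA; have tiY := partition_trivIset partY.
  case/eqP: neq; congr (P ::&: _).
  by rewrite -(def_pblock tiY YB (sAB x Ax)) (def_pblock tiY YC (sAC x Ax)).
- apply/imsetP => -[B YB B0]; have:= partition_neq0 partY YB.
  by rewrite -(coverB B YB) -B0 /cover big_set0 eqxx.
Qed.

Lemma partition_setC_disjoint P Y D :
  partition P D -> partition Y (~: D) -> [disjoint P & Y].
Proof.
move=> partP partY; apply/pred0P => A /=; apply/negP => /andP[PA YA].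
have /set0Pn[x Ax] := partition_neq0 partP PA.
have := subsetP (partitionS partY YA) x Ax.
by rewrite inE (subsetP (partitionS partP PA)).
Qed.

Lemma partitionUC P Y D :
  partition P D -> partition Y (~: D) -> partition (P :|: Y) [set: T].
Proof.
move=> partP partY; apply/and3P; split.
- rewrite /cover bigcup_setU -!/(cover _).
  by rewrite (cover_partition partP) (cover_partition partY) setUCr.
- apply: trivIsetU (partition_trivIset partP) (partition_trivIset partY) _.
  rewrite (cover_partition partP) (cover_partition partY).
  by rewrite disjoints_subset setCK.
- by rewrite inE (partition0 partP) (partition0 partY).
Qed.

(** Since [P] is contained in [Y], a block of [Y] that meets [D] is a block
    of [P]; so the blocks outside [P] avoid [D]. *)
Lemma partitionDC P Y D :
  partition P D -> partition Y [set: T] -> P \subset Y ->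
  partition (Y :\: P) (~: D).
Proof.
move=> partP partY /subsetP sPY; have tiY := partition_trivIset partY.
apply/and3P; split; last by rewrite inE (partition0 partY) andbF.
  apply/eqP/setP => x; rewrite inE -(cover_partition partP).
  apply/bigcupP/idP => [[B /setDP[YB nPB] Bx]|nPx].
    apply: contra nPB => /bigcupP[A PA Ax].
    by rewrite -(def_pblock tiY YB Bx) (def_pblock tiY (sPY A PA) Ax).
  have Yx : x \in cover Y by rewrite (cover_partition partY) inE.
  exists (pblock Y x); last by rewrite mem_pblock.
  rewrite inE pblock_mem // andbT; apply: contra nPx => Pb.
  by apply/bigcupP; exists (pblock Y x) => //; rewrite mem_pblock.
exact: trivIsetD.
Qed.

End Partitions.

(** * The trivial relations *)

Section TrivialRelations.
Variable Omega : finType.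
Implicit Types (x y z : Omega).

Lemma tuple3P (t : triple Omega) : exists x y z, t = [tuple x; y; z].
Proof.
exists (tnth t (inord 0)), (tnth t (inord 1)), (tnth t (inord 2)).
by apply: val_inj; case: t => [[|a [|b [|c []]]]] //= i; rewrite !(tnth_nth a) !inordK.
Qed.

Lemma mem_triv_rel0 x y z :
  ([tuple x; y; z] \in triv_rel0 Omega) = (x == y) && (y == z).
Proof.
apply/imsetP/andP => [[a _ [-> -> ->]]|[/eqP-> /eqP->]]; first by rewrite eqxx.
by exists z.
Qed.

Lemma mem_triv_rel1 x y z :
  ([tuple x; y; z] \in triv_rel1 Omega) = (x != y) && (y == z).
Proof.
apply/imset2P/andP => [[a b _ + [-> -> ->]]|[xy /eqP<-]].
  by rewrite !inE eq_sym => /= ->.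
by exists y x; rewrite // inE eq_sym.
Qed.

Lemma mem_triv_rel2 x y z :
  ([tuple x; y; z] \in triv_rel2 Omega) = (x != y) && (x == z).
Proof.
apply/imset2P/andP => [[a b _ + [-> -> ->]]|[xy /eqP<-]].
  by rewrite !inE => /= ->.
by exists x y; rewrite // inE.
Qed.

Lemma mem_triv_rel3 x y z :
  ([tuple x; y; z] \in triv_rel3 Omega) = (x == y) && (x != z).
Proof.
apply/imset2P/andP => [[a b _ + [-> -> ->]]|[/eqP<- xz]].
  by rewrite !inE => /= ->.
by exists x z; rewrite // inE.
Qed.

Definition mem_triv_rel :=
  (mem_triv_rel0, mem_triv_rel1, mem_triv_rel2, mem_triv_rel3).

Lemma cover_trivial_relations :
  cover (trivial_relations Omega) = ~: nontrivial_triples Omega.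
Proof. by rewrite /cover !bigcup_setU !big_set1 setCK. Qed.

Lemma trivial_relations_trivIset : trivIset (trivial_relations Omega).
Proof.
apply/trivIsetP => A B.
rewrite !inE -!orbA => HA HB neq; apply/pred0P => t /=.
have [x [y [z ->]]] := tuple3P t.
case: (eqVneq x y) => [<-|xy].
  by case/or4P: HA neq => /eqP->; case/or4P: HB => /eqP->;
    rewrite ?eqxx // => _; rewrite !mem_triv_rel eqxx //; case: (x == z).
have neqF : (y == z) && (x == z) = false.
  by apply: contraNF xy => /andP[/eqP-> /eqP->].
by case/or4P: HA neq => /eqP->; case/or4P: HB => /eqP->;
  rewrite ?eqxx // => _; rewrite !mem_triv_rel (negPf xy) //= andbC.
Qed.

Hypothesis Omega2 : 1 < #|Omega|.

(** Two distinct points suffice to separate the trivial relations; over a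
    one-point set all but the first would be empty. *)
Lemma trivial_relations_uniq_neq0 :
  uniq [:: triv_rel0 Omega; triv_rel1 Omega; triv_rel2 Omega; triv_rel3 Omega]
  /\ set0 \notin trivial_relations Omega.
Proof.
have [x [y xy]] : exists x y : Omega, x != y.
  by case/card_gt1P: Omega2 => x [y [_ _ xy]]; exists x, y.
have xyF := negbTE xy; have yxF : (y == x) = false by rewrite eq_sym.
have neqE (A B : {set triple Omega}) t :
    (t \in A) != (t \in B) -> (A == B) = false.
  by move=> neq; apply/eqP => eAB; rewrite eAB eqxx in neq.
(* Each of these triples lies in exactly one of the trivial relations, so it
   separates that relation from the other three and from the empty set. *)
pose t0 := [tuple x; x; x]; pose t1 := [tuple y; x; x].
pose t2 := [tuple x; y; x]; pose t3 := [tuple x; x; y].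
have memE := (mem_triv_rel, in_set0, eqxx, xyF, yxF).
split; rewrite /= !inE !negb_or.
  rewrite !(neqE (triv_rel0 _) _ t0) ?memE //.
  by rewrite !(neqE (triv_rel1 _) _ t1) ?(neqE (triv_rel2 _) _ t2) ?memE.
rewrite !(eq_sym set0) (neqE _ _ t0) ?(neqE (triv_rel1 _) _ t1) ?memE //.
by rewrite (neqE _ _ t2) ?(neqE _ _ t3) ?memE.
Qed.

Lemma card_trivial_relations : #|trivial_relations Omega| = 4.
Proof.
have [/card_uniqP /= <- _] := trivial_relations_uniq_neq0.
by apply: eq_card => A; rewrite !inE -!orbA.
Qed.

Lemma trivial_relations_partition :
  partition (trivial_relations Omega) (~: nontrivial_triples Omega).
Proof.
have [_ n0] := trivial_relations_uniq_neq0.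
by rewrite /partition cover_trivial_relations eqxx trivial_relations_trivIset.
Qed.

End TrivialRelations.

(** * Orbits and invariant relations *)

Section Orbits.
Variables (Omega : finType) (G : groupType).
Variable act : G -> triple Omega -> triple Omega.
Hypothesis hact : group_action act.
Hypothesis hstable : forall g t,
  t \in nontrivial_triples Omega -> act g t \in nontrivial_triples Omega.

(** Stability keeps every orbit inside the nontrivial triples, so the orbits are
    the classes of an equivalence relation on that set. *)
Lemma orbits_partition : partition (orbits act) (nontrivial_triples Omega).
Proof.
have [act1 actM] := hact.
pose r t u := `[< exists g, act g t = u >].
have -> : orbits act = equivalence_partition r (nontrivial_triples Omega).
  apply: eq_in_imset => t Nt; apply/setP => u; rewrite [LHS]inE [RHS]inE.
  case: asboolP => [[g <-]|nu]; last by rewrite /r asboolF // andbF.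
  by rewrite hstable // /r asboolT //; exists g.
apply: equivalence_partitionP => t u v _ _ _; split.
  by apply/asboolP; exists 1.
move=> /asboolP[g <-]; apply/asboolP/asboolP => -[h <-].
  by exists (h * g^-1); rewrite -actM mulgKV.
by exists (h * g); rewrite actM.
Qed.

Lemma orbit_of_invariant t : invariant_rel act (orbit_of act t).
Proof.
move=> g _ /[!inE] /asboolP[h <-].
by apply/asboolP; exists (g * h); rewrite (proj2 hact).
Qed.

Lemma invariant_cover (U : {set {set triple Omega}}) :
  U \subset orbits act -> invariant_rel act (cover U).
Proof.
move=> /subsetP sU g t /bigcupP[A UA At]; apply/bigcupP; exists A => //.
by have /imsetP[u _ eA] := sU A UA; rewrite eA in At *; apply: orbit_of_invariant.
Qed.

(** A relation that meets an orbit at [act g t] contains [t], by applying the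
    inverse of [g], and hence the whole orbit of [t]. *)
Lemma invariant_coarsens (Y : relations Omega) :
  (forall R, R \in Y -> invariant_rel act R) -> coarsens (orbits act) Y.
Proof.
have [act1 actM] := hact.
move=> invY _ B /imsetP[t _ ->] YB /pred0Pn[u /andP[/=]].
rewrite inE => /asboolP[g <-] Bu; apply/subsetP => v /[!inE] /asboolP[h <-].
by rewrite -[t]act1 -(mulVg g) !actM; do 2!apply: (invY B YB).
Qed.

End Orbits.

(** * The procedure *)

Section Procedure.
Variables (Omega : finType) (G : groupType).
Variable act : G -> triple Omega -> triple Omega.
Hypothesis Omega2 : 1 < #|Omega|.
Hypothesis hact : group_action act.
Hypothesis hstable : forall g t,
  t \in nontrivial_triples Omega -> act g t \in nontrivial_triples Omega.
Variable m : nat.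
Hypothesis m_ge3 : 2 < m.

Let orbP := orbits_partition hact hstable.
Let trivP := trivial_relations_partition Omega2.

Lemma hat_partition P : partition P (orbits act) ->
  [/\ partition (hat P) [set: triple Omega], #|hat P| = #|P| + 4,
      hat P :\: trivial_relations Omega = [set cover U | U in P]
    & trivial_relations Omega \subset hat P].
Proof.
move=> partP; have [covP inj_cov] := partition_partition orbP partP.
have dis : [disjoint trivial_relations Omega & [set cover U | U in P]].
  by rewrite disjoint_sym; apply: partition_setC_disjoint covP trivP.
split; last exact: subsetUl.
- by rewrite /hat setUC; apply: partitionUC covP trivP.
- rewrite /hat cardsU disjoint_setI0 // cards0 subn0 card_trivial_relations //.
  by rewrite card_in_imset // addnC.
- by rewrite /hat setDUl setDv set0U; apply/setDidPl; rewrite disjoint_sym.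
Qed.

(** From right to left, the nontrivial relations of [X] form a coarsening of the
    partition into orbits, so they come from some partition [P] of the set of
    orbits, and [X = hat P]. *)
Lemma mem_candidates X : X \in candidates act m <-> invariant_ast act m X.
Proof.
split=> [|[[[partX cardX] valX intX symX trivX] invX]].
  rewrite inE => /andP[/imsetP[P]]; rewrite inE => /andP[partP /eqP cardP] ->.
  case/asboolP=> valX intX symX.
  have [partX cardX nontrivX trivX] := hat_partition partP.
  split.
    by split=> //; split=> //; rewrite cardX cardP addnS subnK.
  move=> R; rewrite nontrivX => /imsetP[U PU ->]; apply: invariant_cover => //.
  exact: partitionS partP PU.
have partN := partitionDC trivP partX trivX; rewrite setCK in partN.
have [P partP covP] :=
  coarsening_is_partition_of_partition orbP partN (invariant_coarsens hact invX).
have hatP : hat P = X by rewrite /hat covP -{1}(setIidPr trivX) setID.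
have [_ cardP _ _] := hat_partition partP.
rewrite inE; apply/andP; split; last exact/asboolP.
apply/imsetP; exists P => //; rewrite inE partP /=.
by rewrite -(eqn_add2r 4) -cardP hatP cardX addnS subnK.
Qed.

End Procedure.

Theorem theorem1 (m : nat) (hm : 4 <= m) (Omega : finType)
    (hn : 3 <= #|Omega|) (G : groupType)
    (act : G -> triple Omega -> triple Omega)
    (hact : group_action act)
    (hstable : forall g t,
       t \in nontrivial_triples Omega -> act g t \in nontrivial_triples Omega)
    (T : {set relations Omega})
    (hT : isom_transversal T (candidates act m)) :
  (forall X, X \in T -> invariant_ast act m X) /\
  (forall X, invariant_ast act m X ->
     exists! Y, Y \in T /\ ast_isomorphic X Y).
Proof.
have candE := mem_candidates (ltnW hn) hact hstable (ltnW hm).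
have [/subsetP sTA transT] := hT; split=> [X /sTA /candE //|X /candE AX].
have isoP Y : Y \in orbit (relations_action Omega) [set: {perm Omega}] X
    <-> ast_isomorphic X Y.
  by split=> [/orbitP[s _ <-]|[s <-]]; [exists s | apply: mem_orbit; rewrite inE].
have meetA : orbit (relations_action Omega) [set: {perm Omega}] X
    :&: candidates act m != set0.
  by apply/set0Pn; exists X; rewrite inE AX andbT orbit_refl.
have /eqP/cards1P[Y TY] := transT X meetA.
have uniqY Z : Z \in T /\ ast_isomorphic X Z <-> Z = Y.
  rewrite -isoP; split=> [[TZ XZ]|->].
    by apply/set1P; rewrite -TY inE TZ.
  by apply/andP; rewrite -in_setI TY set11.
by exists Y; split=> [|Z /uniqY]; [apply/uniqY|].
Qed.
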